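(* Let $N\ge1$, let $\mathcal S=\{s_1,\ldots,s_N\}$ be a family of nondegenerate intervals in $[-1,1]$, and let $\omega\in L^1(-1,1)$ satisfy $\omega(x)>0$ for almost every $x\in(-1,1)$. If $\mathcal S$ is $\omega$-admissible, then the linear map \[ \mathcal D_{\mathcal S}^\omega:\Pi_N\to\mathbb R^N,\qquad p\mapsto\left[\int_{s_1}p'(x)\omega(x)\,dx,\ \ldots,\ \int_{s_N}p'(x)\omega(x)\,dx\right]^\top, \] is surjective and its kernel is exactly $\Pi_0$ (the constant polynomials).
   Context: $\Pi_n$ is the space of real univariate polynomials of degree at most $n$. A nondegenerate interval is $s_i=[a_i,b_i]\subset[-1,1]$ with $a_i<b_i$. The family $\mathcal S$ is called $\omega$-admissible if the linear map $\Pi_{N-1}\to\mathbb R^N$, $q\mapsto\left[\int_{s_1}q\,\omega\,dx,\ldots,\int_{s_N}q\,\omega\,dx\right]^\top$, is an isomorphism. *)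

(* Defs.v *)
From HB Require Import structures.
From mathcomp Require Import all_boot all_order all_algebra.
From mathcomp Require Import all_classical all_reals all_analysis.
From mathcomp Require Import measurable_realfun.

Set Implicit Arguments.
Unset Strict Implicit.
Unset Printing Implicit Defensive.

Import Order.TTheory GRing.Theory Num.Theory.
Import numFieldNormedType.Exports.

Local Open Scope classical_set_scope.
Local Open Scope ring_scope.

(* [{poly_n R}] bounds the size, i.e. degree + 1: the space of polynomials of
   degree at most n is [{poly_n.+1 R}], and for 0 < N the polynomials of degree
   at most N - 1 form [{poly_N R}].
   The weight w is a representative, defined on all of R, of an element of
   L^1(-1, 1). When s_i touches -1 or 1 the value of w there is unconstrained,
   which does not affect the integral. *)

Definition moment_map (R : realType) (N : nat) (w : R -> R) (a b : 'I_N -> R)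
    (q : {poly_N R}) : 'cV[R]_N :=
  \col_i \int[lebesgue_measure]_(x in `[a i, b i]) (q.[x] * w x).

Definition deriv_moment_map (R : realType) (N : nat) (w : R -> R)
    (a b : 'I_N -> R) (p : {poly_N.+1 R}) : 'cV[R]_N :=
  \col_i \int[lebesgue_measure]_(x in `[a i, b i]) (p^`().[x] * w x).

(* An isomorphism is a bijective linear map; linearity is automatic here, see
   [moment_map_linear]. *)
Definition admissible (R : realType) (N : nat) (w : R -> R) (a b : 'I_N -> R) :=
  bijective (moment_map w a b).

Lemma integrable_horner_weight (R : realType) (w : R -> R) (q : {poly R})
    (a b : R) :
  lebesgue_measure.-integrable `]-1, 1[ (EFin \o w) ->
  -1 <= a -> b <= 1 ->
  lebesgue_measure.-integrable `[a, b] (EFin \o (fun x => q.[x] * w x)).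
Proof.
move=> wi a1 b1.
have wci : lebesgue_measure.-integrable `[-1, 1] (EFin \o w).
  apply/integrableP; case/integrableP: wi => mw wfin.
  split; first by
    apply/emeasurable_fun_itv_bndo_bndcP/emeasurable_fun_itv_obnd_cbndP.
  by rewrite integral_itv_bndoo//; exact: measurableT_comp.
have wab : lebesgue_measure.-integrable `[a, b] (EFin \o w).
  apply: integrableS wci => //; apply: subset_itv; by rewrite bnd_simp.
have := @integrableMr _ _ _ lebesgue_measure _ _ (horner q) (EFin \o w).
apply => //.
  apply: measurable_funTS; apply: continuous_measurable_fun.
  exact: continuous_horner.
have cq : compact (horner q @` `[a, b]).
  apply: continuous_compact; last exact: segment_compact.
  exact/continuous_subspaceT/continuous_horner.
have [M [Mreal qM]] := compact_bounded cq.
by exists M; split => // y My x abx; apply: (qM _ My); exists x.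
Qed.

Lemma moment_map_linear (R : realType) (N : nat) (w : R -> R)
    (a b : 'I_N -> R) :
  lebesgue_measure.-integrable `]-1, 1[ (EFin \o w) ->
  (forall i, -1 <= a i) -> (forall i, b i <= 1) ->
  linear (moment_map w a b).
Proof.
move=> wi a1 b1 c p q; apply/colP => i; rewrite !mxE.
have p_int := @integrable_horner_weight R w p _ _ wi (a1 i) (b1 i).
have q_int := @integrable_horner_weight R w q _ _ wi (a1 i) (b1 i).
rewrite -RintegralZl// -RintegralD//; last first.
  have -> : EFin \o (fun x => c * (p.[x] * w x)) =
            EFin \o (fun x => (c *: (p : {poly R})).[x] * w x).
    by apply/funext => x /=; rewrite hornerE mulrA.
  exact: integrable_horner_weight.
by apply: eq_Rintegral => x _; rewrite /= hornerD hornerZ mulrDl mulrA.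
Qed.

(* Main.v *)
Require Import Defs.
From mathcomp Require Import all_boot all_order all_algebra.
From mathcomp Require Import all_classical all_reals all_analysis.
Import Order.TTheory GRing.Theory Num.Theory.
Import numFieldNormedType.Exports.
Local Open Scope classical_set_scope.
Local Open Scope ring_scope.

(** The map factors as [moment_map] after differentiation from $\Pi_N$ to $\Pi_{N-1}$. In
    characteristic zero differentiation is onto ([deriv_surj]) with the constants as kernel
    ([deriv_eq0P]). Admissibility makes the second factor bijective, so the composite keeps both
    properties. *)

Lemma deriv_surj (R : numFieldType) (n : nat) (q : {poly R}) :
  (size q <= n)%N ->
  exists2 p : {poly R}, (size p <= n.+1)%N & p^`() = q.
Proof.
(* Termwise antiderivative; at [i = 0] division by zero yields 0, so the constant term is 0. *)
move=> qn; exists (\poly_(i < n.+1) (q`_i.-1 / i%:R)); first exact: size_poly.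
apply/polyP => i; rewrite coef_deriv coef_poly ltnS.
case: ltnP => [_|ni] /=; first by rewrite -(mulr_natr (_ / _)) divfK ?pnatr_eq0.
by rewrite mul0rn nth_default// (leq_trans qn).
Qed.

(** The coefficient of index [i] in the derivative is [i.+1] times that of index [i.+1] in [p], and
    [i.+1] is not a zero divisor in [R]. *)
Lemma deriv_eq0P (R : numDomainType) (p : {poly R}) :
  p^`() = 0 <-> exists c : R, p = c%:P.
Proof.
split=> [p'0|[c ->]]; last exact: derivC.
exists p`_0; apply/polyP => -[|i]; rewrite coefC//=.
have /eqP := congr1 (fun r : {poly R} => r`_i) p'0.
by rewrite coef_deriv coef0 mulrn_eq0 /= => /eqP.
Qed.

Lemma size_deriv_npoly (R : nzRingType) (n : nat) (p : {poly_n.+1 R}) :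
  (size (p : {poly R})^`() <= n)%N.
Proof.
have [->|p0] := eqVneq (p : {poly R}) 0; first by rewrite deriv0 size_poly0.
by rewrite -ltnS (leq_trans (lt_size_deriv p0))// size_npoly.
Qed.

(** Carries the degree bound, so that the derivative can be fed to [moment_map]. *)
Definition nderiv {R : nzRingType} {n : nat} (p : {poly_n.+1 R}) : {poly_n R} :=
  NPoly (size_deriv_npoly R n p).

Lemma nderiv_linear (R : nzRingType) (n : nat) : linear (@nderiv R n).
Proof. by move=> c p q; apply/val_inj; rewrite /= derivD derivZ. Qed.

Theorem proposition1 (R : realType) (N : nat) (N_ge1 : (1 <= N)%N)
    (a b : 'I_N -> R)
    (a_ge : forall i : 'I_N, -1 <= a i)
    (a_lt_b : forall i : 'I_N, a i < b i)
    (b_le : forall i : 'I_N, b i <= 1)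
    (w : R -> R)
    (w_L1 : lebesgue_measure.-integrable `]-1, 1[ (EFin \o w))
    (w_pos : {ae (@lebesgue_measure R), forall x : R, -1 < x < 1 -> 0 < w x})
    (w_adm : admissible w a b) :
  [/\ linear (deriv_moment_map w a b),
      (forall v : 'cV[R]_N,
         exists p : {poly_N.+1 R}, deriv_moment_map w a b p = v)
    & (forall p : {poly_N.+1 R},
         deriv_moment_map w a b p = 0 <->
         exists c : R, (p : {poly R}) = c%:P)].
Proof.
have mlin := moment_map_linear w_L1 a_ge b_le.
have DE p : deriv_moment_map w a b p = moment_map w a b (nderiv p) by [].
split.
- by move=> c p q; rewrite !DE nderiv_linear mlin.
- move=> v; case: w_adm => g _ gK.
  have [p pN p'E] := deriv_surj R N (g v) (size_npoly (g v)).
  exists (NPoly pN); rewrite DE -[RHS]gK; congr moment_map.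
  exact/val_inj.
- move=> p; rewrite -deriv_eq0P DE.
  have m0 : moment_map w a b 0 = 0.
    (* Linearity with scalar [-1] at [0] and [0] makes the value at [0] equal to its opposite plus
       itself. *)
    by have := mlin (-1) 0 0; rewrite scaler0 addr0 scaleN1r addNr.
  split=> [|p'0]; last by rewrite -m0; congr moment_map; exact/val_inj.
  (* Injectivity of the moment map forces the derivative to vanish. *)
  by rewrite -m0 => /(bij_inj w_adm) /(congr1 val).
Qed.
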